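(* Let $Y$ be a real random variable, $\mathbf{X}$ an $\mathbb{R}^p$-valued random vector and $\mathbf{Z}$ an $\mathbb{R}^q$-valued random vector ($p\ge 0$, $q\ge 1$) on the same probability space, and let $$T = T(Y,\mathbf{Z}|\mathbf{X}) := \frac{\int \mathbb{E}(\mathrm{Var}(\mathbb{P}(Y\ge t|\mathbf{Z},\mathbf{X})|\mathbf{X}))\, d\mu(t)}{\int \mathbb{E}(\mathrm{Var}(1_{\{Y\ge t\}}|\mathbf{X}))\,d\mu(t)},$$ where $\mu$ is the law of $Y$. Suppose that $Y$ is not almost surely equal to a measurable function of $\mathbf{X}$ (when $p=0$, this means that $Y$ is not almost surely a constant). Then $T$ is well-defined (its denominator is nonzero) and $0\le T\le 1$. Moreover, $T=0$ if and only if $Y$ and $\mathbf{Z}$ are conditionally independent given $\mathbf{X}$, and $T=1$ if and only if $Y$ is almost surely equal to a measurable function of $\mathbf{Z}$ given $\mathbf{X}$. When $p=0$, conditional independence given $\mathbf{X}$ simply means unconditional independence.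
   Context: The case $p=0$ means that $\mathbf{X}$ has no components; then conditional expectations, variances and probabilities given $\mathbf{X}$ are interpreted as unconditional ones. $1_{\{Y\ge t\}}$ is the indicator of the event $\{Y\ge t\}$. ''$Y$ is almost surely equal to a measurable function of $\mathbf{Z}$ given $\mathbf{X}$'' means that there is a measurable $f:\mathbb{R}^{p+q}\to\mathbb{R}$ with $Y=f(\mathbf{X},\mathbf{Z})$ almost surely. *)

(* Defs.v *)
From HB Require Import structures.
From mathcomp Require Import all_boot all_order all_algebra.
From mathcomp Require Import all_classical all_reals all_analysis.
From mathcomp Require Import measurable_realfun.

Set Implicit Arguments.
Unset Strict Implicit.
Unset Printing Implicit Defensive.

Import Order.TTheory GRing.Theory Num.Theory.
Import numFieldNormedType.Exports.

Local Open Scope classical_set_scope.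
Local Open Scope ring_scope.
Local Open Scope ereal_scope.

Section conditioning.
Context d d' (Omega : measurableType d) (U : measurableType d') (R : realType).
Variables (P : probability Omega R) (V : Omega -> U).
Implicit Types (W g : Omega -> R) (A : set Omega).

(* g is a version of E(W | V), i.e. of E(W | sigma(V)) *)
Definition is_condexp W g :=
  [/\ measurable_fun [set: g_sigma_algebra_preimageType V] g,
      P.-integrable [set: Omega] (EFin \o g) &
      forall A, g_sigma_algebra_preimage V A ->
        \int[P]_(w in A) (g w)%:E = \int[P]_(w in A) (W w)%:E].

(* An arbitrary version of E(W | V); by [condexpP] below, the choice made by
   [get] is a genuine version as soon as V is measurable and W integrable. *)
Definition condexp W : Omega -> R := get (is_condexp W).

Definition condprob A : Omega -> R := condexp \1_A.

Definition condvar W : Omega -> R :=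
  condexp (fun w => (W w - condexp W w) ^+ 2)%R.

Lemma ex_condexp W : measurable_fun [set: Omega] V ->
  P.-integrable [set: Omega] (EFin \o W) -> exists g, is_condexp W g.
Proof.
move=> mV intW.
pose S := g_sigma_algebra_preimageType V.
pose h : Omega -> S := idfun.
have mS (A : set Omega) : g_sigma_algebra_preimage V A -> measurable A.
  by move=> [B mB <-]; exact: mV.
have mh : measurable_fun [set: Omega] h.
  by move=> _ A mA; rewrite setTI; exact: mS.
pose hm : {mfun Omega >-> S} := HB.pack h (isMeasurableFun.Build _ _ _ _ h mh).
pose Q : probability S R := distribution P hm.
have [nu nuE] : exists nu : {charge set S -> \bar R},
    forall A, nu A = \int[P]_(w in A) (W w)%:E.
  pose nu := pushforward (induced_charge intW) h : {charge set S -> \bar R}.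
  by exists (nu mh).
have nuQ : nu `<< Q.
  apply/null_content_dominatesP => A mA QA0.
  have PA0 : P A = 0 by exact: QA0.
  rewrite nuE; apply: null_set_integral => //.
  - exact: mS.
  - by apply: measurable_funTS; exact: measurable_int intW.
have := @Radon_Nikodym_integrable _ _ _ nu Q nuQ.
set k := Radon_Nikodym _ _ => intk.
have kfin x : k x \is a fin_num by exact: Radon_Nikodym_fin_num.
have kE : EFin \o (fine \o k) = k by apply/funext => x /=; rewrite fineK.
have mk : measurable_fun [set: S] k by exact: measurable_int intk.
have intPk : P.-integrable [set: Omega] k.
  apply/integrableP; split.
    have /= := measurableT_comp mk mh; exact.
  move/integrableP : intk => [_].
  rewrite (ge0_integral_pushforward mh)//; last exact: measurableT_comp.
exists (fine \o k); split.
- exact: measurableT_comp.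
- by rewrite kE.
- move=> A mA.
  have := @Radon_Nikodym_integral _ _ _ nu Q A nuQ mA.
  rewrite nuE => ->.
  under eq_integral do rewrite fineK//.
  rewrite (@integral_pushforward _ _ _ _ _ _ mh P A k)//.
  by apply: integrableS intPk => //; exact: mS.
Qed.

Lemma condexpP W : measurable_fun [set: Omega] V ->
  P.-integrable [set: Omega] (EFin \o W) -> is_condexp W (condexp W).
Proof. by move=> mV intW; apply: getPex; exact: ex_condexp. Qed.

End conditioning.

(* Conditioning on a vector with no components is not conditioning at all. *)
Lemma condexp_tuple0 d (Omega : measurableType d) (R : realType)
    (P : probability Omega R) (X : Omega -> 0.-tuple R) (W : Omega -> R)
    (w : Omega) :
  P.-integrable [set: Omega] (EFin \o W) -> (condexp P X W w)%:E = 'E_P[W].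
Proof.
move=> intW.
have XE : X = cst [tuple] by apply/funext => u; rewrite (tuple0 (X u)).
have mX : measurable_fun [set: Omega] X by rewrite XE.
have [mg _ gE] := condexpP mX intW.
have gcst u : condexp P X W u = condexp P X W w.
  have := mg measurableT [set condexp P X W w] (measurable_set1 _).
  move=> [B mB]; rewrite !setTI => BE.
  suff : [set v | condexp P X W v = condexp P X W w] u by [].
  have : (X @^-1` B) w by rewrite BE.
  rewrite /= => Bw; have : (X @^-1` B) u by rewrite /= XE -(tuple0 (X w)).
  by rewrite BE.
have XT : g_sigma_algebra_preimage X [set: Omega].
  by exists setT => //; rewrite setTI preimage_setT.
rewrite unlock -(gE _ XT).
under eq_integral do rewrite gcst.
rewrite integral_cst// -[LHS]mule1; congr (_ * _).
exact/esym/probability_setT.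
Qed.

Section dependence.
Context d (Omega : measurableType d) (R : realType).
Variable P : probability Omega R.

Definition cond_independent d1 d2 d3 (U1 : measurableType d1)
    (U2 : measurableType d2) (U3 : measurableType d3)
    (Y : Omega -> U1) (Z : Omega -> U2) (X : Omega -> U3) :=
  forall (B : set U1) (C : set U2), measurable B -> measurable C ->
    \forall w \ae P, condprob P X (Y @^-1` B `&` Z @^-1` C) w =
      (condprob P X (Y @^-1` B) w * condprob P X (Z @^-1` C) w)%R.

Definition as_function_of d1 d2 (U1 : measurableType d1)
    (U2 : measurableType d2) (Y : Omega -> U1) (V : Omega -> U2) :=
  exists f : U2 -> U1, measurable_fun [set: U2] f /\
    \forall w \ae P, Y w = f (V w).

Definition joint p q (X : Omega -> p.-tuple R) (Z : Omega -> q.-tuple R)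
    (w : Omega) : (p + q).-tuple R := cat_tuple (X w) (Z w).

Variables (p q : nat) (Y : {RV P >-> R}) (Z : {RV P >-> q.-tuple R})
  (X : {RV P >-> p.-tuple R}).

Definition T_num : \bar R :=
  \int[distribution P Y]_t
    'E_P[condvar P X (condprob P (joint X Z) [set w | (t <= Y w)%R])].

Definition T_den : \bar R :=
  \int[distribution P Y]_t 'E_P[condvar P X \1_[set w | (t <= Y w)%R]].

Definition T_coef : \bar R := T_num / T_den.

End dependence.

(* Main.v *)
Require Import Defs.
From mathcomp Require Import all_boot all_order all_algebra.
From mathcomp Require Import all_classical all_reals all_analysis.
From mathcomp Require Import measurable_realfun.
From mathcomp Require Import ring lra.

(** For a random variable V put v_V(t) = E[P(Y >= t | V)^2], and let mu be the
    law of Y. By orthogonality of conditional expectations (Pythagoras),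
    E[Var(W | V)] = E[W^2] - E[E(W | V)^2]. Applied to W = 1_{Y >= t} and to
    W = P(Y >= t | X, Z), together with the tower property, this turns the two
    integrals of the coefficient into
      numerator   = \int (v_{(X,Z)} - v_X) dmu,
      denominator = \int (v_id      - v_X) dmu,
    where id is the identity of Omega, so that conditioning on id is no loss of
    information and P(Y >= t | id) = 1_{Y >= t}. All three functions lie in
    [0, 1] and v_id >= v_{(X,Z)} >= v_X. Hence T lies in [0, 1], and everything
    rests on when a gap \int (v_{V1} - v_{V2}) dmu, for sigma(V2) contained in
    sigma(V1), vanishes: the denominator is the gap of (id, X), the numerator
    that of ((X,Z), X), and their difference that of (id, (X,Z)).

    The central lemma [survival_gap_eq0] says that the gap is zero iff
    P(Y >= t | V1) = P(Y >= t | V2) almost surely for every real t. A zero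
    integral gives this only for mu-almost every t. The passage to all t uses
    that each v_V is nonincreasing, with variation at most 2 mu([t, s[) over
    [t, s[: if the difference were nonzero at t, it would be nonzero at every
    s >= t for which mu([t, s[) is small, and the set of these s is mu-null
    only if mu([t, +oo[) = 0, where the difference vanishes anyway
    ([measure_itv_null], [ae_eq0_everywhere]).

    It remains to read off the two extreme cases. For V1 = id the condition
    says that each event {Y >= t} is, up to a null set, in sigma(V2); taking
    rational t, one recovers Y as a supremum of rationals, a measurable
    function of V2 ([as_function_of_survivalP]). For V1 = (X, Z), V2 = X the
    condition is conditional independence of Y and Z given X, by two uses of
    the pi-lambda theorem: the rays [t, +oo[ generate the Borel sets
    ([cond_independent_of_survival]), and the events {X in D, Z in C} generate
    sigma(X, Z) ([survival_of_cond_independent]). *)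

Set Implicit Arguments.
Unset Strict Implicit.
Unset Printing Implicit Defensive.

Import Order.TTheory GRing.Theory Num.Theory.
Import numFieldNormedType.Exports.

Local Open Scope classical_set_scope.
Local Open Scope ring_scope.

(** * Essentially bounded random variables *)

Section ess_bounded.
Context d (Omega : measurableType d) (R : realType).
Variable P : probability Omega R.
Implicit Types (f g : Omega -> R) (A : set Omega).

(** The bound is only almost sure because conditional expectations of bounded
    variables are bounded only up to a null set; the variables of this class
    form a ring of integrable functions that conditioning preserves. *)
Definition ess_bounded f :=
  measurable_fun setT f /\ exists M, \forall w \ae P, `|f w| <= M.

Lemma ess_bounded_cst c : ess_bounded (cst c).
Proof. by split => //; exists `|c|; apply: aeW. Qed.

Lemma ess_bounded_indic A : measurable A -> ess_bounded \1_A.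
Proof.
move=> mA; split; first exact: measurable_indic.
by exists 1; apply: aeW => w; rewrite indicE ger0_norm// lern1 leq_b1.
Qed.

Lemma ess_boundedD f g :
  ess_bounded f -> ess_bounded g -> ess_bounded (fun w => f w + g w).
Proof.
move=> [mf [M fM]] [mg [N gN]]; split; first exact: measurable_funD.
exists (M + N); near=> w.
by rewrite (le_trans (ler_normD _ _))// lerD//; [near: w..].
Unshelve. all: by end_near. Qed.

Lemma ess_boundedM f g :
  ess_bounded f -> ess_bounded g -> ess_bounded (fun w => f w * g w).
Proof.
move=> [mf [M fM]] [mg [N gN]]; split; first exact: measurable_funM.
exists (M * N); near=> w.
by rewrite normrM ler_pM//; [near: w..].
Unshelve. all: by end_near. Qed.

Lemma ess_boundedB f g :
  ess_bounded f -> ess_bounded g -> ess_bounded (fun w => f w - g w).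
Proof.
move=> bf bg.
have := ess_boundedD bf (ess_boundedM (ess_bounded_cst (-1)) bg).
by rewrite /=; under eq_fun do rewrite mulN1r.
Qed.

Lemma ess_boundedX f : ess_bounded f -> ess_bounded (fun w => f w ^+ 2).
Proof. by move=> bf; exact: (ess_boundedM bf bf). Qed.

Lemma ess_bounded_integrable f :
  ess_bounded f -> P.-integrable setT (EFin \o f).
Proof.
move=> [mf [M fM]]; apply/integrableP; split; first exact/measurable_EFinP.
apply: (@le_lt_trans _ _ (`|M|%:E * P setT)%E); last first.
  by rewrite lte_mul_pinfty// probability_setT ltry.
apply: integral_le_bound => //; first exact/measurable_EFinP.
by apply: filterS fM => w fM _; rewrite lee_fin (le_trans fM)// ler_norm.
Qed.

Lemma Rintegral_indic f A : measurable A ->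
  \int[P]_w (\1_A w * f w) = \int[P]_(w in A) f w.
Proof.
move=> mA; rewrite [RHS]Rintegral_mkcond; apply: eq_Rintegral => w _.
by rewrite patchE indicE; case: ifPn => _; rewrite ?mul1r ?mul0r.
Qed.

Lemma ess_RintegralD f g : ess_bounded f -> ess_bounded g ->
  \int[P]_w (f w + g w) = \int[P]_w f w + \int[P]_w g w.
Proof.
by move=> bf bg; rewrite RintegralD//; exact: ess_bounded_integrable.
Qed.

Lemma ess_RintegralB f g : ess_bounded f -> ess_bounded g ->
  \int[P]_w (f w - g w) = \int[P]_w f w - \int[P]_w g w.
Proof.
by move=> bf bg; rewrite RintegralB//; exact: ess_bounded_integrable.
Qed.

Lemma ess_RintegralZ c f : ess_bounded f ->
  \int[P]_w (c * f w) = c * \int[P]_w f w.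
Proof. by move=> bf; rewrite RintegralZl//; exact: ess_bounded_integrable. Qed.

Lemma EFin_Rintegral f A : measurable A -> ess_bounded f ->
  (\int[P]_(w in A) f w)%:E = (\int[P]_(w in A) (f w)%:E)%E.
Proof.
move=> mA bf; rewrite /Rintegral fineK//; apply: integrable_fin_num => //.
by apply: integrableS (ess_bounded_integrable bf).
Qed.

Lemma eq_ae_Rintegral f g : measurable_fun setT f -> measurable_fun setT g ->
  (\forall w \ae P, f w = g w) -> \int[P]_w f w = \int[P]_w g w.
Proof.
move=> mf mg fg; congr fine; apply: ae_eq_integral => //.
- exact/measurable_EFinP.
- exact/measurable_EFinP.
- by apply: filterS fg => w -> _.
Qed.

Lemma le_ae_Rintegral f g : ess_bounded f -> ess_bounded g ->
  (\forall w \ae P, f w <= g w) -> \int[P]_w f w <= \int[P]_w g w.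
Proof.
move=> bf bg fg.
have mm : measurable_fun setT (fun w => Num.max (f w) (g w)).
  by apply: measurable_maxr; [exact: bf.1|exact: bg.1].
have gE : \forall w \ae P, g w = Num.max (f w) (g w).
  by apply: filterS fg => w /max_idPr.
have [M gM] := bg.2.
rewrite (eq_ae_Rintegral bg.1 mm gE); apply: le_Rintegral => //.
- exact: ess_bounded_integrable.
- apply: ess_bounded_integrable; split => //; exists M.
  by near=> w; have <- : g w = Num.max (f w) (g w); near: w.
- by move=> w _; rewrite le_max lexx.
Unshelve. all: by end_near. Qed.

Lemma le_ae_Rintegral_in f g A : measurable A ->
  ess_bounded f -> ess_bounded g -> (\forall w \ae P, f w <= g w) ->
  \int[P]_(w in A) f w <= \int[P]_(w in A) g w.
Proof.
move=> mA bf bg fg; rewrite -(Rintegral_indic f mA) -(Rintegral_indic g mA).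
apply: le_ae_Rintegral.
- by apply: ess_boundedM => //; exact: ess_bounded_indic.
- by apply: ess_boundedM => //; exact: ess_bounded_indic.
- by apply: filterS fg => w fg; rewrite ler_wpM2l.
Qed.

Lemma ge0_ae_Rintegral0 f : ess_bounded f -> (\forall w \ae P, 0 <= f w) ->
  \int[P]_w f w = 0 -> \forall w \ae P, f w = 0.
Proof.
move=> bf f0 If0.
have /(ae_eq_integral_abs P measurableT) : measurable_fun setT (EFin \o f).
  by apply/measurable_EFinP; exact: bf.1.
case=> + _; rewrite /=.
have -> : (\int[P]_w `|(f w)%:E| = \int[P]_w (f w)%:E)%E.
  apply: ae_eq_integral => //.
  - by apply: measurableT_comp => //; apply/measurable_EFinP; exact: bf.1.
  - by apply/measurable_EFinP; exact: bf.1.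
  - by apply: filterS f0 => w f0 _; rewrite gee0_abs// lee_fin.
rewrite -EFin_Rintegral// If0 => /(_ erefl).
by apply: filterS => w /(_ I)[].
Qed.

Lemma Rintegral_sqr0 f : ess_bounded f ->
  \int[P]_w (f w ^+ 2) = 0 -> \forall w \ae P, f w = 0.
Proof.
move=> bf /(ge0_ae_Rintegral0 (ess_boundedX bf)) f0.
have /f0 : \forall w \ae P, 0 <= f w ^+ 2 by apply: aeW => w; exact: sqr_ge0.
by apply: filterS => w /eqP; rewrite sqrf_eq0 => /eqP.
Qed.

End ess_bounded.

(** * Pulling out measurable factors *)

Section pull_out.
Context d d' (Omega : measurableType d) (U : measurableType d') (R : realType).
Variables (P : probability Omega R) (V : Omega -> U).
Hypothesis mV : measurable_fun setT V.
Implicit Types (f g H W : Omega -> R) (A : set Omega).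

Local Notation sigmaV := (g_sigma_algebra_preimageType V).

Lemma preimage_measurable A : g_sigma_algebra_preimage V A -> measurable A.
Proof. by move=> [B mB <-]; exact: mV. Qed.

Lemma preimage_measurable_fun f :
  measurable_fun [set: sigmaV] f -> measurable_fun [set: Omega] f.
Proof. by move=> mf _ B mB; apply: preimage_measurable; exact: mf. Qed.

Import HBNNSimple.

(** A simple function measurable for sigma(V) is a finite combination of
    indicators of events of sigma(V), on which f integrates to 0. *)
Lemma pull_out_nnsfun f (h : {nnsfun sigmaV >-> R}) : ess_bounded P f ->
  (forall A, g_sigma_algebra_preimage V A -> \int[P]_w (\1_A w * f w) = 0) ->
  \int[P]_w (h w * f w) = 0.
Proof.
move=> bf f0.
pose s : seq R := finmap.enum_fset (fset_set (range h)).
have mh i : g_sigma_algebra_preimage V (h @^-1` [set s`_i]).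
  exact: (measurable_funPTI h).
pose F i w := s`_i * (\1_(h @^-1` [set s`_i]) w * f w).
have -> : (fun w => h w * f w) = (fun w => \sum_(i < size s) F i w).
  apply/funext => w; rewrite fimfunEord mulr_suml.
  by apply: eq_bigr => i _; rewrite /F mulrA.
have bi i : ess_bounded P (fun w => \1_(h @^-1` [set s`_i]) w * f w).
  apply: ess_boundedM => //; apply: ess_bounded_indic.
  exact: preimage_measurable.
have bF i : ess_bounded P (F i).
  by apply: ess_boundedM => //; exact: ess_bounded_cst.
suff sumF n : ess_bounded P (fun w => \sum_(i < n) F i w) /\
    \int[P]_w (\sum_(i < n) F i w) = 0 by have [] := sumF (size s).
elim: n => [|n [IHb IH]].
  under eq_fun do rewrite big_ord0.
  by split; [exact: ess_bounded_cst|rewrite Rintegral_cst// mul0r].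
under eq_fun do rewrite big_ord_recr/=.
split; first exact: ess_boundedD.
by rewrite ess_RintegralD// IH ess_RintegralZ ?f0 ?mulr0 ?addr0.
Qed.

(** Approximate H from below by simple functions h n; the products h n * f are
    dominated by |H * f|, so their zero integrals pass to the limit. *)
Lemma pull_out_ge0 f H : ess_bounded P f ->
  (forall A, g_sigma_algebra_preimage V A -> \int[P]_w (\1_A w * f w) = 0) ->
  measurable_fun [set: sigmaV] H -> ess_bounded P H -> (forall w, 0 <= H w) ->
  \int[P]_w (H w * f w) = 0.
Proof.
move=> bf f0 mH bH H0.
have mHE : measurable_fun [set: sigmaV] (EFin \o H) by exact/measurable_EFinP.
have HE0 (w : sigmaV) : [set: sigmaV] w -> (0 <= (EFin \o H) w)%E.
  by move=> _; rewrite lee_fin H0.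
pose h := nnsfun_approx measurableT mHE.
have hH n w : h n w <= H w.
  have := @le_approx _ sigmaV R setT (EFin \o H) n w HE0 Logic.I.
  by rewrite -(nnsfun_approxE measurableT mHE) lee_fin.
have mhf n : measurable_fun [set: Omega] (fun w => h n w * f w).
  apply: measurable_funM; last exact: bf.1.
  exact: (preimage_measurable_fun (@measurable_funP _ _ _ _ setT (h n))).
have bHf := ess_boundedM bH bf.
have [] := @dominated_convergence _ _ _ P setT measurableT
  (fun n w => (h n w * f w)%:E) (fun w => (H w * f w)%:E)
  (EFin \o (fun w => `|H w * f w|)).
- by move=> n; exact/measurable_EFinP.
- exact/measurable_EFinP/bHf.1.
- apply: aeW => w _; apply: cvg_EFin; first exact: nearW.
  apply: cvgMr_tmp.
  have := @cvg_nnsfun_approx _ sigmaV R setT measurableT _ mHE HE0 w Logic.I.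
  by move/fine_cvg.
- by apply: integrable_norm; exact: ess_bounded_integrable.
- apply: aeW => w n _; rewrite lee_fin/= !normrM ler_wpM2r//.
  by rewrite !ger0_norm.
move=> _ _ cvgI.
have cvg0 : (\int[P]_w (h n w * f w)%:E)%E @[n --> \oo] --> (0%:E : \bar R).
  apply: cvg_near_cst; apply: nearW => n.
  rewrite -EFin_Rintegral ?pull_out_nnsfun//.
  split => //; have [M HfM] := bHf.2; exists M; apply: filterS HfM => w.
  apply: le_trans.
  by rewrite !normrM ler_wpM2r// !ger0_norm.
by rewrite /Rintegral (cvg_unique _ cvgI cvg0).
Qed.

(** With f = W - E(W | V), this is the rule that sigma(V)-measurable factors
    may be pulled out of a conditional expectation. *)
Lemma pull_out f H : ess_bounded P f ->
  (forall A, g_sigma_algebra_preimage V A -> \int[P]_w (\1_A w * f w) = 0) ->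
  measurable_fun [set: sigmaV] H -> ess_bounded P H ->
  \int[P]_w (H w * f w) = 0.
Proof.
move=> bf f0 mH [mH' [M HM]].
have bp : ess_bounded P H^\+.
  split; first exact: measurable_funrpos.
  exists M; apply: filterS HM => w; apply: le_trans.
  by rewrite ger0_norm ?funrpos_ge0// /funrpos ge_max ler_norm/=.
have bn : ess_bounded P H^\-.
  split; first exact: measurable_funrneg.
  exists M; apply: filterS HM => w; apply: le_trans.
  by rewrite ger0_norm ?funrneg_ge0// /funrneg ge_max -normrN ler_norm/=.
have -> : (fun w => H w * f w) = (fun w => H^\+ w * f w - H^\- w * f w).
  by apply/funext => w; rewrite -mulrBl -[in LHS](funrposBneg H).
rewrite ess_RintegralB; [|exact: ess_boundedM..].
rewrite !pull_out_ge0 ?subrr//.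
- exact: measurable_funrneg.
- exact: measurable_funrpos.
Qed.

End pull_out.

(** * Conditional expectation of essentially bounded variables *)

Section condexp.
Context d d' (Omega : measurableType d) (U : measurableType d') (R : realType).
Variables (P : probability Omega R) (V : Omega -> U).
Hypothesis mV : measurable_fun setT V.
Implicit Types (f g H W : Omega -> R) (A : set Omega).

Local Notation sigmaV := (g_sigma_algebra_preimageType V).
Local Notation E := (condexp P V).

(** The event {g < f} itself belongs to sigma(V): testing the hypothesis on it
    forces it to be null. *)
Lemma sub_Rintegral_ae_le f g :
  measurable_fun [set: sigmaV] f -> measurable_fun [set: sigmaV] g ->
  P.-integrable setT (EFin \o f) -> P.-integrable setT (EFin \o g) ->
  (forall A, g_sigma_algebra_preimage V A ->
     \int[P]_(w in A) f w <= \int[P]_(w in A) g w) ->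
  \forall w \ae P, f w <= g w.
Proof.
move=> mf mg intf intg fg.
pose A := [set w | g w < f w].
have sA : g_sigma_algebra_preimage V A.
  have := @measurable_fun_ltr _ sigmaV R setT _ _ mg mf.
  move=> /(_ measurableT [set true] I).
  by rewrite setTI.
have mA := preimage_measurable mV sA.
have intfA : P.-integrable A (EFin \o f) by exact: integrableS intf.
have intgA : P.-integrable A (EFin \o g) by exact: integrableS intg.
have intD : P.-integrable A (EFin \o (fun w => f w - g w)).
  exact: (integrableB mA intfA intgA).
have /(ae_eq_integral_abs P mA) :
    measurable_fun A (EFin \o (fun w => f w - g w)).
  exact: measurable_int intD.
case=> + _; case.
  have -> : (\int[P]_(w in A) `|(EFin \o (fun w => f w - g w)%R) w| =
             \int[P]_(w in A) (f w - g w)%:E)%E.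
    apply: eq_integral => w /set_mem Aw.
    by rewrite /= ger0_norm// subr_ge0 ltW.
  rewrite -[LHS]fineK; last exact: integrable_fin_num.
  congr EFin; apply/eqP; rewrite eq_le; apply/andP; split; last first.
    by apply: Rintegral_ge0 => w Aw; rewrite subr_ge0 ltW.
  have := fg _ sA; rewrite -subr_le0 -RintegralB//.
move=> N [mN PN AN]; exists N; split=> // w /= /negP; rewrite -ltNge => Aw.
apply: AN => /= /(_ Aw)[] /eqP.
by rewrite subr_eq0 gt_eqF.
Qed.

Lemma condexp_ess W : ess_bounded P W ->
  [/\ measurable_fun [set: sigmaV] (E W), ess_bounded P (E W) &
      forall A, g_sigma_algebra_preimage V A ->
        \int[P]_(w in A) E W w = \int[P]_(w in A) W w].
Proof.
move=> bW.
have intW := ess_bounded_integrable bW.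
have [mE iE EE] := condexpP mV intW.
have EER A : g_sigma_algebra_preimage V A ->
    \int[P]_(w in A) E W w = \int[P]_(w in A) W w.
  by move=> sA; rewrite /Rintegral EE.
split => //; split; first exact: (preimage_measurable_fun mV).
have [M WM] := bW.2; exists M.
have intc c : P.-integrable setT (EFin \o cst c).
  exact/ess_bounded_integrable/ess_bounded_cst.
have le1 : \forall w \ae P, E W w <= M.
  apply: (@sub_Rintegral_ae_le _ (cst M)) => // A sA.
  rewrite EER//; apply: le_ae_Rintegral_in => //.
  + exact: preimage_measurable sA.
  + exact: ess_bounded_cst.
  + by apply: filterS WM => w; rewrite ler_norml => /andP[].
have le2 : \forall w \ae P, - M <= E W w.
  apply: (@sub_Rintegral_ae_le (cst (- M))) => // A sA.
  rewrite EER//; apply: le_ae_Rintegral_in => //.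
  + exact: preimage_measurable sA.
  + exact: ess_bounded_cst.
  + by apply: filterS WM => w; rewrite ler_norml => /andP[].
by near=> w; rewrite ler_norml; apply/andP; split; near: w.
Unshelve. all: by end_near. Qed.

Lemma condexp_meas W : ess_bounded P W -> measurable_fun [set: sigmaV] (E W).
Proof. by case/condexp_ess. Qed.

Lemma condexp_bounded W : ess_bounded P W -> ess_bounded P (E W).
Proof. by case/condexp_ess. Qed.

Lemma le_condexp f g : ess_bounded P f -> ess_bounded P g ->
  (\forall w \ae P, f w <= g w) -> \forall w \ae P, E f w <= E g w.
Proof.
move=> bf bg fg; apply: sub_Rintegral_ae_le.
- exact: condexp_meas.
- exact: condexp_meas.
- exact/ess_bounded_integrable/condexp_bounded.
- exact/ess_bounded_integrable/condexp_bounded.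
- move=> A sA; have [_ _ ->//] := condexp_ess bf.
  have [_ _ ->//] := condexp_ess bg.
  by apply: le_ae_Rintegral_in => //; exact: preimage_measurable sA.
Qed.

Lemma condexp_mul W H : ess_bounded P W ->
  measurable_fun [set: sigmaV] H -> ess_bounded P H ->
  \int[P]_w (H w * E W w) = \int[P]_w (H w * W w).
Proof.
move=> bW mH bH; have [_ bE EE] := condexp_ess bW.
apply/eqP; rewrite -subr_eq0 -ess_RintegralB; [|exact: ess_boundedM..].
under eq_Rintegral do rewrite -mulrBr.
apply/eqP/(pull_out mV) => //; first exact: ess_boundedB.
move=> A sA; have mA := preimage_measurable mV sA.
have b1 := ess_bounded_indic P mA.
under eq_Rintegral do rewrite mulrBr.
rewrite ess_RintegralB ?Rintegral_indic ?EE ?subrr//; exact: ess_boundedM.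
Qed.

Lemma condexp_int W : ess_bounded P W -> \int[P]_w E W w = \int[P]_w W w.
Proof.
move=> bW; have [_ _ ->//] := condexp_ess bW.
by exists setT => //; rewrite setTI preimage_setT.
Qed.

(** The difference of two versions is orthogonal to every sigma(V)-measurable
    variable, hence to itself. *)
Lemma condexp_unique W g : ess_bounded P W ->
  measurable_fun [set: sigmaV] g -> ess_bounded P g ->
  (forall A, g_sigma_algebra_preimage V A ->
    \int[P]_w (\1_A w * g w) = \int[P]_w (\1_A w * W w)) ->
  \forall w \ae P, E W w = g w.
Proof.
move=> bW mg bg gW.
have bE := condexp_bounded bW.
have bD := ess_boundedB bE bg.
have : \forall w \ae P, E W w - g w = 0.
  apply: Rintegral_sqr0 => //.
  under eq_Rintegral do rewrite expr2.
  apply: (pull_out mV) => //; last first.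
    by apply: measurable_funB => //; exact: condexp_meas.
  move=> A sA; have mA := preimage_measurable mV sA.
  have b1 := ess_bounded_indic P mA.
  under eq_Rintegral do rewrite mulrBr.
  rewrite ess_RintegralB; [|exact: ess_boundedM..].
  have [_ _ EE] := condexp_ess bW.
  by rewrite gW// !Rintegral_indic// EE// subrr.
by apply: filterS => w /eqP; rewrite subr_eq0 => /eqP.
Qed.

End condexp.

(** * Orthogonality and the tower property *)

Section condexp_consequences.
Context d d' (Omega : measurableType d) (U : measurableType d') (R : realType).
Variables (P : probability Omega R) (V : Omega -> U).
Hypothesis mV : measurable_fun setT V.
Implicit Types (f g W : Omega -> R) (A : set Omega).

Local Notation sigmaV := (g_sigma_algebra_preimageType V).
Local Notation E := (condexp P V).

Lemma eq_condexp f g : ess_bounded P f -> ess_bounded P g ->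
  (\forall w \ae P, f w = g w) -> \forall w \ae P, E f w = E g w.
Proof.
move=> bf bg fg.
have h1 : \forall w \ae P, E f w <= E g w.
  by apply: le_condexp => //; apply: filterS fg => w ->.
have h2 : \forall w \ae P, E g w <= E f w.
  by apply: le_condexp => //; apply: filterS fg => w ->.
by near=> w; apply: le_anti; apply/andP; split; near: w.
Unshelve. all: by end_near. Qed.

Lemma condexp_id W : ess_bounded P W -> measurable_fun [set: sigmaV] W ->
  \forall w \ae P, E W w = W w.
Proof. by move=> bW mW; apply: condexp_unique. Qed.

Lemma condprob_ge0 A : measurable A -> \forall w \ae P, 0 <= condprob P V A w.
Proof.
move=> mA; have b1 := ess_bounded_indic P mA.
have b0 := ess_bounded_cst P 0.
have h : \forall w \ae P, E (cst 0) w <= condprob P V A w.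
  by apply: le_condexp => //; apply: aeW => w /=; rewrite indicE ler0n.
have h0 : \forall w \ae P, E (cst 0) w = 0 by exact: condexp_id.
by near=> w; have <- : E (cst 0) w = 0; near: w.
Unshelve. all: by end_near. Qed.

Lemma condprob_le1 A : measurable A -> \forall w \ae P, condprob P V A w <= 1.
Proof.
move=> mA; have b1 := ess_bounded_indic P mA.
have b0 := ess_bounded_cst P 1.
have h : \forall w \ae P, condprob P V A w <= E (cst 1) w.
  by apply: le_condexp => //; apply: aeW => w /=; rewrite indicE lern1 leq_b1.
have h0 : \forall w \ae P, E (cst 1) w = 1 by exact: condexp_id.
by near=> w; have <- : E (cst 1) w = 1; near: w.
Unshelve. all: by end_near. Qed.

(** W - E(W | V) is orthogonal to E(W | V). *)
Lemma condexp_pythagoras W : ess_bounded P W ->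
  \int[P]_w ((W w - E W w) ^+ 2) =
  \int[P]_w (W w ^+ 2) - \int[P]_w (E W w ^+ 2).
Proof.
move=> bW; have bE := condexp_bounded mV bW; have mE := condexp_meas mV bW.
have bWE := ess_boundedM bE bW.
have bW2 := ess_boundedX bW; have bE2 := ess_boundedX bE.
have WE : \int[P]_w (E W w * W w) = \int[P]_w (E W w ^+ 2).
  by rewrite -(condexp_mul mV)//.
have -> : (fun w => (W w - E W w) ^+ 2) =
    (fun w => (W w ^+ 2 - 2 * (E W w * W w)) + E W w ^+ 2).
  by apply/funext => w; ring.
have b2 : ess_bounded P (fun w => 2 * (E W w * W w)).
  by apply: ess_boundedM => //; exact: ess_bounded_cst.
rewrite ess_RintegralD//; last exact: ess_boundedB.
by rewrite ess_RintegralB// ess_RintegralZ// WE; ring.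
Qed.

Lemma expectation_condvar W : ess_bounded P W ->
  ('E_P[condvar P V W] = (\int[P]_w (W w ^+ 2) - \int[P]_w (E W w ^+ 2))%:E)%E.
Proof.
move=> bW; have bE := condexp_bounded mV bW.
have bD := ess_boundedX (ess_boundedB bW bE).
rewrite -(condexp_pythagoras bW) unlock /condvar -(condexp_int mV bD).
by rewrite EFin_Rintegral//; exact: condexp_bounded.
Qed.

End condexp_consequences.

Section nested.
Context d d1 d2 (Omega : measurableType d) (U1 : measurableType d1)
  (U2 : measurableType d2) (R : realType).
Variables (P : probability Omega R) (V1 : Omega -> U1) (V2 : Omega -> U2).
Hypothesis mV1 : measurable_fun setT V1.
Hypothesis mV2 : measurable_fun setT V2.
Hypothesis V21 : g_sigma_algebra_preimage V2 `<=` g_sigma_algebra_preimage V1.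

Lemma condexp_tower W : ess_bounded P W ->
  \forall w \ae P, condexp P V2 (condexp P V1 W) w = condexp P V2 W w.
Proof.
move=> bW; apply: condexp_unique => //.
- exact: condexp_bounded.
- exact: condexp_meas.
- exact: condexp_bounded.
- move=> A A2; have mA := preimage_measurable mV2 A2.
  have [_ _ E1] := condexp_ess mV1 bW; have [_ _ E2] := condexp_ess mV2 bW.
  by rewrite !Rintegral_indic// E1 ?E2//; exact: V21.
Qed.

(** Pythagoras for the variable E(W | V1), whose projection on sigma(V2) is
    E(W | V2) by the tower property. *)
Lemma condexp_nested_pythagoras W : ess_bounded P W ->
  \int[P]_w ((condexp P V1 W w - condexp P V2 W w) ^+ 2) =
  \int[P]_w (condexp P V1 W w ^+ 2) - \int[P]_w (condexp P V2 W w ^+ 2).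
Proof.
move=> bW; have b1 := condexp_bounded mV1 bW; have b2 := condexp_bounded mV2 bW.
have b21 := condexp_bounded mV2 b1; have T := condexp_tower bW.
have -> : \int[P]_w (condexp P V2 W w ^+ 2) =
    \int[P]_w (condexp P V2 (condexp P V1 W) w ^+ 2).
  apply: eq_ae_Rintegral; [exact: (ess_boundedX b2).1|
    exact: (ess_boundedX b21).1|by apply: filterS T => w ->].
apply: etrans; last exact: (condexp_pythagoras mV2 b1).
apply: eq_ae_Rintegral.
- exact: (ess_boundedX (ess_boundedB b1 b2)).1.
- exact: (ess_boundedX (ess_boundedB b1 b21)).1.
- by apply: filterS T => w ->.
Qed.

End nested.

(** * From almost every to every threshold *)

Section ray.
Context (R : realType) (mu : probability R R).
Local Open Scope ereal_scope.

(** The set J of the lemma is an interval starting at t. If it is bounded with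
    supremum b, its being null puts b in J, whereas the intervals
    [t, b + 1/(n + 1)[ all have mass at least c and decrease to the null
    interval [t, b]. So J is the whole ray. *)
Lemma measure_itv_null (t c : R) : (0 < c)%R ->
  mu.-negligible [set s | (t <= s)%R /\ mu `[t, s[%classic < c%:E] ->
  mu `[t, +oo[%classic = 0.
Proof.
move=> c0; set J := [set s | _] => negJ.
have muS (A B : set R) :
    measurable A -> measurable B -> A `<=` B -> mu A <= mu B.
  by move=> mA mB AB; apply: le_measure => //; exact: mem_set.
have Jdown s s' : J s' -> (t <= s <= s')%R -> J s.
  move=> [_ s'c] /andP[ts ss']; split => //; apply: le_lt_trans s'c.
  apply: muS => // x /=; rewrite !in_itv/= => /andP[-> /=] /lt_le_trans; exact.
have mJ : measurable J.
  apply: is_interval_measurable => x y Jx Jy z /andP[xz zy].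
  by apply: (Jdown _ _ Jy); rewrite zy (le_trans Jx.1 xz).
have J0 : mu J = 0 by exact: measure_negligible.
have Jt : J t by split => //; rewrite set_itvco0 measure0 lte_fin.
have subJ0 (A : set R) : measurable A -> A `<=` J -> mu A = 0.
  move=> mA AJ; apply/eqP; rewrite -measure_le0 -J0; exact: muS.
have [Jub|Jnub] := pselect (has_ubound J); last first.
  apply: subJ0 => // s; rewrite /= in_itv/= andbT => ts.
  have [s' Js' ss'] : exists2 s', J s' & (s <= s')%R.
    apply: contrapT => h; apply: Jnub; exists s => s' Js'.
    by rewrite leNgt; apply/negP => ss'; apply: h; exists s' => //; exact: ltW.
  by apply: Jdown Js' _; rewrite ts.
have Jsup : has_sup J by split => //; exists t.
pose b := sup J.
have tb : (t <= b)%R by exact: sup_upper_bound Jsup _ Jt.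
have tbJ : `[t, b[%classic `<=` J.
  move=> s; rewrite /= in_itv/= => /andP[ts sb].
  have bs : (0 < b - s)%R by rewrite subr_gt0.
  have [s' Js' ss'] := sup_adherent bs Jsup.
  apply: Jdown Js' _; rewrite ts/= ltW//.
  by move: ss'; rewrite -/b opprB addrCA subrr addr0.
have Jb : J b by split => //; rewrite (subJ0 _ _ tbJ)// lte_fin.
pose F n := `[t, (b + n.+1%:R^-1)%R[%classic : set R.
have mF n : measurable (F n) by exact: measurable_itv.
have FE : \bigcap_n F n = `[t, b]%classic.
  apply/seteqP; split => s.
    move=> Fs; have := Fs 0%N Logic.I; rewrite /F/= !in_itv/= => /andP[-> _]/=.
    apply/ler_addgt0Pr => e e0.
    have [n _ ne] := near_infty_natSinv_lt (PosNum e0).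
    have := Fs n Logic.I; rewrite /F/= in_itv/= => /andP[_ /ltW sb].
    rewrite (le_trans sb)// lerD2l ltW//; exact: (ne n (leqnn n)).
  rewrite /= in_itv/= => /andP[ts sb] n _; rewrite /F/= in_itv/= ts/=.
  by rewrite (le_lt_trans sb)// ltrDl.
have Fc n : c%:E <= mu (F n).
  rewrite leNgt; apply/negP => Fc.
  suff : (b + n.+1%:R^-1 <= b)%R by rewrite leNgt ltrDl invr_gt0 ltr0n.
  apply: sup_upper_bound => //; split => //.
  by rewrite (le_trans tb)// lerDl.
have b0 : mu `[t, b]%classic = 0.
  by apply: subJ0 => // s; rewrite /= in_itv/= => /(Jdown _ _ Jb).
have : mu (F n) @[n --> \oo] --> 0.
  rewrite -b0 -FE; apply: nonincreasing_cvg_mu => //.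
  - apply: (@le_lt_trans _ _ 1); last exact: ltry.
    exact: probability_le1.
  - by rewrite FE.
  - move=> m n mn; apply/subsetPset => s.
    rewrite /F/= !in_itv/= => /andP[-> /=].
    by move=> /lt_le_trans; apply; rewrite lerD2l lef_pV2 ?posrE// ler_nat.
move=> cvgF; have : c%:E <= lim (mu (F n) @[n --> \oo]).
  by apply: lime_ge; [apply/cvg_ex; exists 0|exact: nearW].
by rewrite (cvg_lim _ cvgF)// lee_fin leNgt c0.
Qed.

(** If phi t is nonzero then, by the bound on its variation, phi is nonzero at
    every s >= t with mu([t, s[) < |phi t| / 4. By hypothesis these s are
    negligible, so the ray from t is null and the tail bound gives
    phi t = 0. *)
Lemma ae_eq0_everywhere (phi : R -> R) :
  (forall t s, (t <= s)%R ->
    `|phi t - phi s|%:E <= 2%:E * mu `[t, s[%classic) ->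
  (forall t, `|phi t|%:E <= 2%:E * mu `[t, +oo[%classic) ->
  (\forall t \ae mu, phi t = 0%R) -> forall t, phi t = 0%R.
Proof.
move=> lip tail phi0 t; apply/eqP; rewrite -normr_le0 -lee_fin.
rewrite leNgt lte_fin normr_gt0; apply/negP => phit.
pose c := (`|phi t| / 2)%R.
have c0 : (0 < c)%R by rewrite divr_gt0// normr_gt0.
suff mu0 : mu `[t, +oo[%classic = 0.
  have := tail t; rewrite mu0 mule0 lee_fin normr_le0 => /eqP phit0.
  by rewrite phit0 eqxx in phit.
apply: (@measure_itv_null _ (c / 2)%R); first by rewrite divr_gt0.
apply: negligibleS phi0 => s [ts muts] /= phis.
have := lip t s ts; rewrite phis subr0 leNgt => /negP; apply.
apply: (@lt_le_trans _ _ (2%:E * (c / 2)%:E)); first by rewrite lte_pmul2l.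
by rewrite -EFinM lee_fin; rewrite /c; have := normr_ge0 (phi t); lra.
Qed.

End ray.

(** * Conditional survival functions *)

Section survival.
Context d (Omega : measurableType d) (R : realType).
Variables (P : probability Omega R) (Y : {RV P >-> R}).

Local Notation mu := (distribution P Y).

Definition survival (t : R) : set Omega := [set w | t <= Y w].

Lemma survivalE t : survival t = Y @^-1` `[t, +oo[.
Proof. by apply/seteqP; split => w /=; rewrite /survival/= in_itv/= andbT. Qed.

Lemma measurable_survival t : measurable (survival t).
Proof. by rewrite survivalE; exact: measurable_funPTI. Qed.

Lemma ess_bounded_survival t : ess_bounded P \1_(survival t).
Proof. exact/ess_bounded_indic/measurable_survival. Qed.

Lemma Rintegral_survival t :
  (\int[P]_w (\1_(survival t) w : R))%:E = mu `[t, +oo[%classic.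
Proof.
rewrite EFin_Rintegral//; last exact: ess_bounded_survival.
rewrite integral_indic ?setIT//; last exact: measurable_survival.
by rewrite survivalE.
Qed.

Lemma Rintegral_survivalB t s : t <= s ->
  (\int[P]_w (\1_(survival t) w : R) - \int[P]_w (\1_(survival s) w : R))%:E =
  mu `[t, s[%classic.
Proof.
move=> ts; rewrite EFinB !Rintegral_survival.
have -> : `[t, s[%classic = `[t, +oo[%classic `\` `[s, +oo[%classic :> set R.
  apply/seteqP; split => x /=; rewrite !in_itv/= ?andbT.
    by move=> /andP[-> xs]; split => //; apply/negP; rewrite -ltNge.
  by move=> [-> /negP]; rewrite -ltNge.
rewrite measureD//; last by rewrite (le_lt_trans (probability_le1 _ _))// ltry.
congr (_ - mu _)%E; apply/seteqP; split => x /=; rewrite !in_itv/= ?andbT.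
  by move=> sx; split => //; exact: le_trans sx.
by case.
Qed.

Section conditional_survival.
Context d' (U : measurableType d') (V : Omega -> U).
Hypothesis mV : measurable_fun setT V.

(** This is the function v_V of the introduction. *)
Definition cond_survival_sq t := \int[P]_w (condprob P V (survival t) w ^+ 2).

Lemma ess_bounded_cond_survival t : ess_bounded P (condprob P V (survival t)).
Proof. exact/(condexp_bounded mV)/ess_bounded_survival. Qed.

Lemma cond_survival_nincr t s : t <= s ->
  \forall w \ae P, condprob P V (survival s) w <= condprob P V (survival t) w.
Proof.
move=> ts; apply: le_condexp => //; try exact: ess_bounded_survival.
apply: aeW => w; rewrite !indicE ler_nat.
have [sY|//] := boolP (w \in survival s).
rewrite mem_set//; move/set_mem : sY; exact: le_trans.
Qed.

Lemma cond_survival_sq_nincr t s : t <= s ->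
  cond_survival_sq s <= cond_survival_sq t.
Proof.
move=> ts; apply: le_ae_Rintegral.
- exact/ess_boundedX/ess_bounded_cond_survival.
- exact/ess_boundedX/ess_bounded_cond_survival.
- have h0 := condprob_ge0 P mV (measurable_survival s).
  have hl := cond_survival_nincr ts.
  near=> w.
  have : 0 <= condprob P V (survival s) w by near: w.
  have : condprob P V (survival s) w <= condprob P V (survival t) w by near: w.
  nra.
Unshelve. all: by end_near. Qed.

(** For 0 <= b <= a <= 1 one has a^2 - b^2 <= 2 (a - b), and the expectations of
    the conditional survival functions are the unconditional ones. *)
Lemma cond_survival_sq_var t s : t <= s ->
  ((cond_survival_sq t - cond_survival_sq s)%:E <= 2%:E * mu `[t, s[%classic)%E.
Proof.
move=> ts; rewrite -Rintegral_survivalB// -EFinM lee_fin.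
have bt := ess_bounded_cond_survival t; have bs := ess_bounded_cond_survival s.
have sE r : \int[P]_w (\1_(survival r) w : R) =
    \int[P]_w condprob P V (survival r) w.
  by rewrite condexp_int//; exact: ess_bounded_survival.
have bt2 := ess_boundedX bt; have bs2 := ess_boundedX bs.
rewrite /cond_survival_sq !sE -!ess_RintegralB//.
rewrite -ess_RintegralZ; last exact: ess_boundedB.
apply: le_ae_Rintegral.
- by apply: ess_boundedB; exact: ess_boundedX.
- by apply: ess_boundedM; [exact: ess_bounded_cst|exact: ess_boundedB].
- have h0 := condprob_ge0 P mV (measurable_survival s).
  have h1 := condprob_le1 P mV (measurable_survival t).
  have hl := cond_survival_nincr ts.
  near=> w.
  have : 0 <= condprob P V (survival s) w by near: w.
  have : condprob P V (survival t) w <= 1 by near: w.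
  have : condprob P V (survival s) w <= condprob P V (survival t) w by near: w.
  nra.
Unshelve. all: by end_near. Qed.

Lemma cond_survival_sq_ge0 t : 0 <= cond_survival_sq t.
Proof. by apply: Rintegral_ge0 => w _; exact: sqr_ge0. Qed.

Lemma cond_survival_sq_tail t :
  ((cond_survival_sq t)%:E <= mu `[t, +oo[%classic)%E.
Proof.
rewrite -Rintegral_survival lee_fin -(condexp_int mV (ess_bounded_survival t)).
have bt := ess_bounded_cond_survival t.
apply: le_ae_Rintegral => //; first exact: ess_boundedX.
have h0 := condprob_ge0 P mV (measurable_survival t).
have h1 := condprob_le1 P mV (measurable_survival t).
near=> w.
have : 0 <= condprob P V (survival t) w by near: w.
have : condprob P V (survival t) w <= 1 by near: w.
by rewrite /condprob; nra.
Unshelve. all: by end_near. Qed.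

Lemma cond_survival_sq_le1 t : cond_survival_sq t <= 1.
Proof.
rewrite -lee_fin (le_trans (cond_survival_sq_tail t))//; exact: probability_le1.
Qed.

Lemma measurable_cond_survival_sq : measurable_fun setT cond_survival_sq.
Proof.
apply: nonincreasing_measurable; first exact: measurableT.
by move=> t s; exact: cond_survival_sq_nincr.
Qed.

End conditional_survival.

Lemma cond_survival_sq_id t :
  cond_survival_sq (@idfun Omega) t = \int[P]_w (\1_(survival t) w ^+ 2).
Proof.
apply: eq_ae_Rintegral.
- apply: (ess_boundedX (ess_bounded_cond_survival _ _)).1; exact: measurable_id.
- exact: (ess_boundedX (ess_bounded_survival t)).1.
- have mm : measurable_fun [set: g_sigma_algebra_preimageType (@idfun Omega)]
      (\1_(survival t) : Omega -> R).
    move=> _ B mB; exists (\1_(survival t) @^-1` B) => //.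
    by rewrite -[X in measurable X]setTI; exact: (ess_bounded_survival t).1.
  have := condexp_id (@measurable_id _ Omega setT) (ess_bounded_survival t) mm.
  by apply: filterS => w; rewrite /condprob => ->.
Qed.

End survival.

(** * Being a function of a random variable *)

Section function_of.
Context d (Omega : measurableType d) (R : realType).
Variables (P : probability Omega R) (Y : {RV P >-> R}).
Context d' (U : measurableType d') (V : Omega -> U).
Hypothesis mV : measurable_fun setT V.

(** Y is the supremum of the rationals r with r <= Y, and for each of them the
    event {r <= Y} is almost surely of the form {V in B}. *)
Lemma as_function_of_rays :
  (forall t, exists B : set U, measurable B /\
     \forall w \ae P, (t <= Y w) <-> B (V w)) ->
  as_function_of P Y V.
Proof.
(* An enumeration of the rationals of R: r (pickle q) = ratr q. *)
pose r (n : nat) : R := ratr (odflt 0 (unpickle n)).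
move=> h; have [B rB] := choice (fun n => h (r n)).
pose g (u : U) (n : nat) : \bar R := (if u \in B n then (r n)%:E else -oo)%E.
exists (fun u => fine (esups (g u) 0%N)); split.
  apply: measurableT_comp => //.
  apply: measurable_fun_esups => n.
  apply: measurable_fun_ifT => //.
  apply: (measurable_fun_bool true).
  rewrite setTI (_ : _ @^-1` _ = B n); first exact: (rB n).1.
  by apply/seteqP; split => u /=; [exact: set_mem|exact: mem_set].
have : \forall w \ae P, forall n, (r n <= Y w) <-> B n (V w).
  by apply/ae_foralln => n; exact: (rB n).2.
apply: filterS => w YB.
suff -> : esups (g (V w)) 0%N = (Y w)%:E by [].
rewrite /esups/=; apply/eqP; rewrite eq_le; apply/andP; split.
  apply: ub_ereal_sup => _ [n _ <-]; rewrite /g; case: ifPn => [|_].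
    by rewrite inE => /YB; rewrite lee_fin.
  by rewrite leNye.
apply/lee_addgt0Pr => e e0.
have /rat_in_itvoo[q] : Y w - e < Y w by rewrite gtrBl.
rewrite in_itv/= => /andP[eq qY].
rewrite -leeBlDr// -EFinB (@le_trans _ _ (ratr q)%:E)//.
  by rewrite lee_fin ltW.
apply: ereal_sup_ubound; exists (pickle q) => //.
have rq : r (pickle q) = ratr q by rewrite /r pickleK.
by rewrite /g ifT ?rq// inE; apply/YB; rewrite rq ltW.
Qed.

(** A version of P(Y >= t | V) that equals the indicator of {Y >= t} exhibits
    that event, up to a null set, as one of sigma(V): the event where the
    version takes the value 1. *)
Lemma as_function_of_survivalP : as_function_of P Y V <->
  forall t, \forall w \ae P,
    condprob P V (survival Y t) w = \1_(survival Y t) w.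
Proof.
split=> [[f [mf Yf]] t|h].
- pose A := V @^-1` (f @^-1` `[t, +oo[).
  have mB : measurable (f @^-1` `[t, +oo[).
    by rewrite -[X in measurable X]setTI; apply: mf.
  have sA : g_sigma_algebra_preimage V A.
    by exists (f @^-1` `[t, +oo[) => //; rewrite setTI.
  have mA := preimage_measurable mV sA.
  have bA := ess_bounded_indic P mA.
  have AS : \forall w \ae P, \1_A w = \1_(survival Y t) w :> R.
    apply: filterS Yf => w Yf; rewrite !indicE; congr (_%:R).
    have AE : A w <-> survival Y t w by rewrite /A/survival/= in_itv/= andbT Yf.
    by congr nat_of_bool; apply/idP/idP; rewrite !inE => /AE.
  have EA : \forall w \ae P, condexp P V \1_A w = \1_A w.
    by apply: condexp_id => //; exact: measurable_indic.
  have EAS : \forall w \ae P,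
      condexp P V \1_A w = condprob P V (survival Y t) w.
    by apply: eq_condexp => //; exact: ess_bounded_survival.
  near=> w.
  have <- : condexp P V \1_A w = condprob P V (survival Y t) w by near: w.
  have <- : \1_A w = \1_(survival Y t) w :> R by near: w.
  by near: w.
- apply: as_function_of_rays => t.
  have := condexp_meas mV (ess_bounded_survival Y t).
  move=> /(_ measurableT [set 1] (measurable_set1 _)) [B mB].
  rewrite !setTI => BE; exists B; split => //.
  apply: filterS (h t) => w hw.
  have -> : B (V w) = (condprob P V (survival Y t) w = 1).
    by rewrite -[LHS]/((V @^-1` B) w) BE.
  rewrite hw indicE; split => [tY|].
    by rewrite mem_set.
  by case: (boolP (w \in _)) => [/set_mem//|_ /eqP]; rewrite eq_sym oner_eq0.
Unshelve. all: by end_near. Qed.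

End function_of.

(** * The gap between two conditional survival functions *)

Section gap.
Context d (Omega : measurableType d) (R : realType).
Variables (P : probability Omega R) (Y : {RV P >-> R}).

Local Notation mu := (distribution P Y).

Definition survival_gap d1 d2 (U1 : measurableType d1) (U2 : measurableType d2)
    (V1 : Omega -> U1) (V2 : Omega -> U2) : R :=
  \int[mu]_t (cond_survival_sq Y V1 t - cond_survival_sq Y V2 t).

Lemma ess_bounded_cond_survival_sq d1 (U1 : measurableType d1)
    (V1 : Omega -> U1) : measurable_fun setT V1 ->
  ess_bounded mu (cond_survival_sq Y V1).
Proof.
move=> mV1; split; first exact: measurable_cond_survival_sq.
exists 1; apply: aeW => t; rewrite ger0_norm ?cond_survival_sq_ge0//.
exact: cond_survival_sq_le1.
Qed.

Lemma survival_gapD d1 d2 d3 (U1 : measurableType d1) (U2 : measurableType d2)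
    (U3 : measurableType d3)
    (V1 : Omega -> U1) (V2 : Omega -> U2) (V3 : Omega -> U3) :
  measurable_fun setT V1 -> measurable_fun setT V2 -> measurable_fun setT V3 ->
  survival_gap V1 V3 = survival_gap V1 V2 + survival_gap V2 V3.
Proof.
move=> m1 m2 m3.
rewrite /survival_gap -ess_RintegralD; [|by apply: ess_boundedB;
  exact: ess_bounded_cond_survival_sq..].
by apply: eq_Rintegral => t _; ring.
Qed.

Section nested_gap.
Context d1 d2 (U1 : measurableType d1) (U2 : measurableType d2).
Variables (V1 : Omega -> U1) (V2 : Omega -> U2).
Hypothesis mV1 : measurable_fun setT V1.
Hypothesis mV2 : measurable_fun setT V2.
Hypothesis V21 : g_sigma_algebra_preimage V2 `<=` g_sigma_algebra_preimage V1.

Lemma le_cond_survival_sq t :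
  cond_survival_sq Y V2 t <= cond_survival_sq Y V1 t.
Proof.
have bS := ess_bounded_survival Y t.
rewrite -subr_ge0 -(condexp_nested_pythagoras mV1 mV2 V21 bS).
by apply: Rintegral_ge0 => w _; exact: sqr_ge0.
Qed.

Lemma survival_gap_ge0 : 0 <= survival_gap V1 V2.
Proof.
by apply: Rintegral_ge0 => t _; rewrite subr_ge0 le_cond_survival_sq.
Qed.

(** The integrand is nonnegative, so a zero gap makes it vanish mu-almost
    everywhere; the control of its variation by mu makes it vanish everywhere.
    At each t it is the squared L2 distance of the two conditional survival
    functions. *)
Lemma survival_gap_eq0 : survival_gap V1 V2 = 0 <->
  forall t, \forall w \ae P,
    condprob P V1 (survival Y t) w = condprob P V2 (survival Y t) w.
Proof.
have b1 := ess_bounded_cond_survival_sq mV1.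
have b2 := ess_bounded_cond_survival_sq mV2.
split=> [gap0 t|h]; last first.
  rewrite /survival_gap (_ : (fun t => _) = cst 0) ?Rintegral_cst ?mul0r//.
  apply/funext => t; apply/eqP; rewrite subr_eq0; apply/eqP.
  apply: eq_ae_Rintegral.
  - exact: (ess_boundedX (ess_bounded_cond_survival _ mV1 _)).1.
  - exact: (ess_boundedX (ess_bounded_cond_survival _ mV2 _)).1.
  - by apply: filterS (h t) => w ->.
have ae0 : \forall t \ae mu,
    cond_survival_sq Y V1 t - cond_survival_sq Y V2 t = 0.
  apply: ge0_ae_Rintegral0 => //; first exact: ess_boundedB.
  by apply: aeW => s; rewrite subr_ge0 le_cond_survival_sq.
have : cond_survival_sq Y V1 t - cond_survival_sq Y V2 t = 0.
  apply: (ae_eq0_everywhere (mu := mu)) ae0 t => [t s ts|t].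
  - have v1 := cond_survival_sq_var Y mV1 ts.
    have v2 := cond_survival_sq_var Y mV2 ts.
    have m1 := cond_survival_sq_nincr Y mV1 ts.
    have m2 := cond_survival_sq_nincr Y mV2 ts.
    set c1t := cond_survival_sq Y V1 t in v1 m1 *.
    set c2t := cond_survival_sq Y V2 t in v2 m2 *.
    set c1s := cond_survival_sq Y V1 s in v1 m1 *.
    set c2s := cond_survival_sq Y V2 s in v2 m2 *.
    have [le12|le21] := leP (c2t - c2s) (c1t - c1s).
    (* a difference of two nonincreasing functions varies at most as much as
       the one of them that varies more *)
    + by apply: le_trans v1; rewrite lee_fin ger0_norm; lra.
    + by apply: le_trans v2; rewrite lee_fin ler0_norm; lra.
  - rewrite ger0_norm ?subr_ge0 ?le_cond_survival_sq//.
    apply: (@le_trans _ _ (mu `[t, +oo[%classic)); last first.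
      by rewrite lee_pemull// lee_fin ler1n.
    apply: le_trans (cond_survival_sq_tail Y mV1 t).
    by rewrite lee_fin gerBl cond_survival_sq_ge0.
rewrite -(condexp_nested_pythagoras mV1 mV2 V21 (ess_bounded_survival Y t)).
move=> /Rintegral_sqr0 h; have : \forall w \ae P,
    condprob P V1 (survival Y t) w - condprob P V2 (survival Y t) w = 0.
  by apply: h; apply: ess_boundedB; exact: ess_bounded_cond_survival.
by apply: filterS => w /eqP; rewrite subr_eq0 => /eqP.
Qed.

End nested_gap.

End gap.

(** * Conditional independence *)

Section pi_lambda.
Context d d' (Omega : measurableType d) (U : measurableType d') (R : realType).
Variables (P : probability Omega R) (V : Omega -> U).
Hypothesis mV : measurable_fun setT V.

(** A variable whose integral vanishes over a pi-system of events and over the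
    whole space integrates to 0 over the generated sigma-algebra, since the
    sets with zero integral form a Dynkin system. *)
Lemma Rintegral_pi_lambda (G : set (set U)) (f : Omega -> R) :
  ess_bounded P f -> setI_closed G -> G `<=` measurable ->
  \int[P]_w f w = 0 ->
  (forall B, G B -> \int[P]_w (\1_(V @^-1` B) w * f w) = 0) ->
  forall B, <<s G >> B -> \int[P]_w (\1_(V @^-1` B) w * f w) = 0.
Proof.
move=> bf GI Gm fT fG B.
have mVB (C : set U) : measurable C -> measurable (V @^-1` C).
  by move=> mC; rewrite -[X in measurable X]setTI; exact: mV.
pose D := [set C : set U | measurable C /\
  (\int[P]_(w in V @^-1` C) (f w)%:E = 0)%E].
have intf := ess_bounded_integrable bf.
have DE C : measurable C -> D C <-> \int[P]_w (\1_(V @^-1` C) w * f w) = 0.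
  move=> mC; rewrite Rintegral_indic; last exact: mVB.
  split=> [[_]|C0]; first by rewrite /Rintegral => ->.
  by split => //; rewrite -EFin_Rintegral ?C0//; exact: mVB.
suff GD : <<s G >> `<=` D.
  by move=> /GD DB; apply/(DE _ DB.1).
rewrite -setI_closed_g_dynkin_g_sigma_algebra//.
apply: smallest_sub; last first.
  by move=> C GC; apply/DE; [exact: Gm|exact: fG].
split.
- split => //; rewrite preimage_setT -EFin_Rintegral ?fT//.
- move=> C [mC C0]; apply/DE; first exact: measurableC.
  have bC := ess_bounded_indic P (mVB _ mC).
  have -> : (fun w => \1_(V @^-1` (~` C)) w * f w) =
      (fun w => f w - \1_(V @^-1` C) w * f w).
    apply/funext => w; rewrite preimage_setC !indicE in_setC.
    by case: (_ \in _); rewrite ?mul0r ?mul1r ?subrr ?subr0.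
  rewrite ess_RintegralB//; last exact: ess_boundedM.
  by rewrite fT (DE _ mC).1 ?subrr.
- move=> F tF DF; split.
    by apply: bigcup_measurable => k _; exact: (DF k).1.
  rewrite preimage_bigcup integral_bigcup//.
  + by apply: eseries0 => i _ _; exact: (DF i).2.
  + apply/trivIsetP => i j _ _ ij; rewrite -preimage_setI.
    by move/trivIsetP : tF => ->//; rewrite preimage_set0.
  + by move=> k; apply: mVB; exact: (DF k).1.
  + apply: integrableS intf => //; apply: bigcup_measurable => k _.
    by apply: mVB; exact: (DF k).1.
Qed.

End pi_lambda.

Section cond_independence.
Context d d1 d2 d3 (Omega : measurableType d) (U1 : measurableType d1)
  (U2 : measurableType d2) (U3 : measurableType d3) (R : realType).
Variables (P : probability Omega R) (Y : {RV P >-> R}).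
Variables (V : Omega -> U1) (X : Omega -> U2) (Z : Omega -> U3).
Hypothesis mV : measurable_fun setT V.
Hypothesis mX : measurable_fun setT X.
Hypothesis mZ : measurable_fun setT Z.
Hypothesis XV : g_sigma_algebra_preimage X `<=` g_sigma_algebra_preimage V.
Hypothesis ZV : g_sigma_algebra_preimage Z `<=` g_sigma_algebra_preimage V.

Local Notation sigmaX := (g_sigma_algebra_preimageType X).
Local Notation sigmaV := (g_sigma_algebra_preimageType V).
Local Notation E := (condprob P X).

Lemma sub_measurable_fun (f : Omega -> R) :
  measurable_fun [set: sigmaX] f -> measurable_fun [set: sigmaV] f.
Proof. by move=> mf _ B mB; apply: XV; exact: mf. Qed.

Lemma condprob_pull_out (A D : set Omega) (H : Omega -> R) :
  measurable A -> g_sigma_algebra_preimage X D ->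
  measurable_fun [set: sigmaX] H -> ess_bounded P H ->
  \int[P]_w (\1_D w * (H w * \1_A w)) = \int[P]_w (\1_D w * (H w * E A w)).
Proof.
move=> mA sD mH bH.
have bD := ess_bounded_indic P (preimage_measurable mX sD).
have msD : measurable_fun [set: sigmaX] (\1_D : Omega -> R).
  exact: (@measurable_indic _ sigmaX).
under eq_Rintegral do rewrite mulrA.
under [RHS]eq_Rintegral do rewrite mulrA.
rewrite -(condexp_mul mX)//; first exact: ess_bounded_indic.
- exact: measurable_funM.
- exact: ess_boundedM.
Qed.

(** Let A = {Z in C} and D in sigma(X). For S = {Y >= t} the hypothesis gives
      E[1_D 1_A 1_S] = E[1_D 1_A P(S | X)] = E[1_D P(A | X) P(S | X)]
                     = E[1_D P(A | X) 1_S],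
    that is, 1_D (1_A - P(A | X)) integrates to 0 over S. The rays form a
    pi-system generating the Borel sets, so the same holds over any {Y in B},
    and P(A | X) P(Y in B | X) is a version of P(Y in B, A | X). *)
Lemma cond_independent_of_survival :
  (forall t, \forall w \ae P,
    condprob P V (survival Y t) w = condprob P X (survival Y t) w) ->
  cond_independent P Y Z X.
Proof.
move=> VX B C mB mC.
pose A := Z @^-1` C.
have sA : g_sigma_algebra_preimage V A.
  by apply: ZV; exists C => //; rewrite setTI.
have mA := preimage_measurable mV sA.
have mYB (B' : set R) : measurable B' -> measurable (Y @^-1` B').
  by move=> mB'; exact: measurable_funPTI.
have bA := ess_bounded_indic P mA.
have bEA : ess_bounded P (E A) by exact: condexp_bounded.
have mEA : measurable_fun [set: sigmaX] (E A) by exact: condexp_meas.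
have bB := ess_bounded_indic P (mYB _ mB).
have bEB : ess_bounded P (E (Y @^-1` B)) by exact: condexp_bounded.
have mEB : measurable_fun [set: sigmaX] (E (Y @^-1` B)) by exact: condexp_meas.
apply: condexp_unique => //.
- by apply: ess_bounded_indic; apply: measurableI => //; exact: mYB.
- exact: measurable_funM.
- exact: ess_boundedM.
move=> D sD.
have mD := preimage_measurable mX sD; have bD := ess_bounded_indic P mD.
pose f w := \1_D w * (\1_A w - E A w) : R.
have bf : ess_bounded P f by apply: ess_boundedM => //; exact: ess_boundedB.
have sDV := XV sD.
have msDA : measurable_fun [set: sigmaV] (fun w => \1_D w * \1_A w : R).
  by apply: measurable_funM; exact: (@measurable_indic _ sigmaV).
have bDA := ess_boundedM bD bA; have bDE := ess_boundedM bD bEA.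
have fE B' w : \1_(Y @^-1` B') w * f w =
    \1_D w * \1_A w * \1_(Y @^-1` B') w - \1_D w * (E A w * \1_(Y @^-1` B') w).
  by rewrite /f; ring.
have ray t : \int[P]_w (\1_(survival Y t) w * f w) = 0.
  rewrite survivalE; under eq_Rintegral do rewrite fE.
  rewrite -survivalE; set S := survival Y t.
  have bS : ess_bounded P \1_S := ess_bounded_survival Y t.
  have mS : measurable S := measurable_survival Y t.
  have bES : ess_bounded P (E S) by exact: condexp_bounded.
  have mES : measurable_fun [set: sigmaX] (E S) by exact: condexp_meas.
  have bVS : ess_bounded P (condprob P V S) by exact: condexp_bounded.
  rewrite ess_RintegralB; [|exact: ess_boundedM|
    by apply: ess_boundedM => //; exact: ess_boundedM].
  rewrite (condprob_pull_out mS sD mEA bEA).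
  under [X in _ - X = _]eq_Rintegral do rewrite (mulrC (E A _)).
  rewrite -(condprob_pull_out mA sD mES bES).
  rewrite -(condexp_mul mV bS msDA bDA); apply/eqP; rewrite subr_eq0; apply/eqP.
  apply: eq_ae_Rintegral.
  - exact: (ess_boundedM bDA bVS).1.
  - exact: (ess_boundedM bD (ess_boundedM bES bA)).1.
  - apply: filterS (VX t) => w; rewrite -/S /condprob => ->.
    by rewrite -mulrA; congr (_ * _); rewrite mulrC.
have IB : \int[P]_w (\1_(Y @^-1` B) w * f w) = 0.
  apply: (@Rintegral_pi_lambda _ _ _ _ _ P Y _ (@RGenCInfty.G R) f) => //.
  - move=> _ _ [x ->] [y ->]; exists (Num.max x y).
    by apply/seteqP; split => z /=; rewrite !in_itv/= !andbT ge_max => /andP.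
  - by move=> _ [x ->]; exact: measurable_itv.
  - rewrite /f; under eq_Rintegral do rewrite mulrBr.
    rewrite ess_RintegralB//.
    have msD : measurable_fun [set: sigmaX] (\1_D : Omega -> R).
      exact: (@measurable_indic _ sigmaX).
    by rewrite (condexp_mul mX bA msD bD) subrr.
  - by move=> _ [x ->]; rewrite -survivalE.
  - have RE : @measurable _ R = <<s @RGenCInfty.G R >>.
      exact: RGenCInfty.measurableE.
    by rewrite -RE.
move: IB; under eq_Rintegral do rewrite fE.
rewrite ess_RintegralB; [|exact: ess_boundedM|
  by apply: ess_boundedM => //; exact: ess_boundedM].
rewrite (condprob_pull_out (mYB _ mB) sD mEA bEA) => /eqP.
rewrite subr_eq0 => /eqP IB.
apply/esym; apply: etrans; last (apply: etrans; first exact: IB).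
  by apply: eq_Rintegral => w _; rewrite indicI/=; ring.
by apply: eq_Rintegral => w _; ring.
Qed.

(** To recognise P(S | X), where S = {Y >= t}, as a version of P(S | V), it
    suffices to integrate over the generating events D `&` C with D in sigma(X)
    and C in sigma(Z), where
      E[1_D 1_C P(S | X)] = E[1_D P(C | X) P(S | X)] = E[1_D P(S `&` C | X)]. *)
Lemma survival_of_cond_independent :
  g_sigma_algebra_preimage V `<=`
    <<s [set A | exists D C, [/\ g_sigma_algebra_preimage X D,
       g_sigma_algebra_preimage Z C & A = D `&` C]] >> ->
  cond_independent P Y Z X ->
  forall t, \forall w \ae P,
    condprob P V (survival Y t) w = condprob P X (survival Y t) w.
Proof.
set G := [set A | _] => VG YZX t.
pose S := survival Y t.
have mS := measurable_survival Y t; have bS := ess_bounded_survival Y t.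
have bES : ess_bounded P (E S) by exact: condexp_bounded.
have mES : measurable_fun [set: sigmaX] (E S) by exact: condexp_meas.
have bf := ess_boundedB bES bS.
apply: condexp_unique => //; first exact: sub_measurable_fun.
move=> A sA; have bA := ess_bounded_indic P (preimage_measurable mV sA).
apply/eqP; rewrite -subr_eq0 -ess_RintegralB; [|exact: ess_boundedM..].
under eq_Rintegral do rewrite -mulrBr.
apply/eqP; apply: (Rintegral_pi_lambda (V := @idfun Omega) _ (G := G)) => //.
- exact: measurable_id.
- move=> _ _ [D1 [C1 [sD1 sC1 ->]]] [D2 [C2 [sD2 sC2 ->]]].
  exists (D1 `&` D2), (C1 `&` C2); split; last by rewrite setIACA.
  + exact: (@measurableI _ sigmaX).
  + exact: (@measurableI _ (g_sigma_algebra_preimageType Z)).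
- move=> _ [D [C [sD sC ->]]]; apply: measurableI.
  + exact: preimage_measurable sD.
  + exact: preimage_measurable sC.
- by rewrite ess_RintegralB// condexp_int// subrr.
- move=> _ [D [C [sD [C0 mC0 CE] ->]]]; rewrite preimage_id.
  rewrite setTI in CE; rewrite -{C}CE; set C := Z @^-1` C0.
  have mC : measurable C by rewrite /C -[X in measurable X]setTI; exact: mZ.
  have mD := preimage_measurable mX sD.
  have bD := ess_bounded_indic P mD; have bC := ess_bounded_indic P mC.
  have mSC : measurable (S `&` C) by exact: measurableI.
  have bSC := ess_bounded_indic P mSC.
  have bEC : ess_bounded P (E C) by exact: condexp_bounded.
  have bESC : ess_bounded P (E (S `&` C)) by exact: condexp_bounded.
  have -> : (fun w => \1_(D `&` C) w * (E S w - \1_S w)) =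
      (fun w => \1_D w * (E S w * \1_C w) - \1_D w * \1_(S `&` C) w).
    by apply/funext => w; rewrite !indicI/=; ring.
  rewrite ess_RintegralB; [|by do 2 apply: ess_boundedM => //|
    exact: ess_boundedM].
  rewrite (condprob_pull_out mC sD mES bES).
  have msD : measurable_fun [set: sigmaX] (\1_D : Omega -> R).
    exact: (@measurable_indic _ sigmaX).
  rewrite -(condexp_mul mX bSC msD bD).
  apply/eqP; rewrite subr_eq0; apply/eqP; apply: eq_ae_Rintegral.
  + exact: (ess_boundedM bD (ess_boundedM bES bEC)).1.
  + exact: (ess_boundedM bD bESC).1.
  + have := YZX _ _ (measurable_itv `[t, +oo[) mC0.
    rewrite -survivalE -/S -/C; apply: filterS => w SC.
    by rewrite -SC.
- exact: VG.
Qed.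

End cond_independence.

(** * The sigma-algebra of a concatenated vector *)

Section joint.
Context d (Omega : measurableType d) (R : realType) (p q : nat).
Variables (X : Omega -> p.-tuple R) (Z : Omega -> q.-tuple R).

Local Notation sigmaXZ := (g_sigma_algebra_preimageType (joint X Z)).

Lemma measurable_cat_tuple d0 (T : measurableType d0) (f : T -> p.-tuple R)
    (g : T -> q.-tuple R) : measurable_fun setT f -> measurable_fun setT g ->
  measurable_fun setT (fun x => cat_tuple (f x) (g x) : (p + q).-tuple R).
Proof.
move=> /measurable_fun_tnthP mf /measurable_fun_tnthP mg.
apply/measurable_fun_tnthP => i; rewrite -(fintype.splitK i).
case: (fintype.split i) => j /=.
- rewrite (_ : _ \o _ = @tnth p R ^~ j \o f)//.
  by apply/funext => x /=; rewrite tnth_lshift.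
- rewrite (_ : _ \o _ = @tnth q R ^~ j \o g)//.
  by apply/funext => x /=; rewrite tnth_rshift.
Qed.

Lemma measurable_joint_sigma : measurable_fun [set: sigmaXZ] (joint X Z).
Proof. by move=> _ B mB; exists B. Qed.

Lemma joint_sigma_l :
  g_sigma_algebra_preimage X `<=` g_sigma_algebra_preimage (joint X Z).
Proof.
suff mX : measurable_fun [set: sigmaXZ] X by move=> _ [B mB <-]; exact: mX.
apply/measurable_fun_tnthP => i.
rewrite (_ : _ \o _ = @tnth (p + q) R ^~ (lshift q i) \o joint X Z); last first.
  by apply/funext => x; rewrite /= /joint tnth_lshift.
by move/measurable_fun_tnthP: measurable_joint_sigma.
Qed.

Lemma joint_sigma_r :
  g_sigma_algebra_preimage Z `<=` g_sigma_algebra_preimage (joint X Z).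
Proof.
suff mZ : measurable_fun [set: sigmaXZ] Z by move=> _ [B mB <-]; exact: mZ.
apply/measurable_fun_tnthP => i.
rewrite (_ : _ \o _ = @tnth (p + q) R ^~ (rshift p i) \o joint X Z); last first.
  by apply/funext => x; rewrite /= /joint tnth_rshift.
by move/measurable_fun_tnthP: measurable_joint_sigma.
Qed.

Lemma joint_sigma_rectangles :
  g_sigma_algebra_preimage (joint X Z) `<=`
    <<s [set A | exists D C, [/\ g_sigma_algebra_preimage X D,
       g_sigma_algebra_preimage Z C & A = D `&` C]] >>.
Proof.
set G := [set A | _].
have mX : measurable_fun [set: g_sigma_algebraType G] X.
  move=> _ B mB; apply: sub_sigma_algebra; exists (X @^-1` B), setT; split.
  - by exists B; rewrite ?setTI.
  - by exists setT; rewrite ?preimage_setT ?setTI.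
  - by rewrite setTI setIT.
have mZ : measurable_fun [set: g_sigma_algebraType G] Z.
  move=> _ B mB; apply: sub_sigma_algebra; exists setT, (Z @^-1` B); split.
  - by exists setT; rewrite ?preimage_setT ?setTI.
  - by exists B; rewrite ?setTI.
  - by rewrite setTI.
by move=> _ [B mB <-]; exact: (measurable_cat_tuple mX mZ).
Qed.

End joint.

(** * Numerator and denominator as gaps *)

Section coefficient.
Context d (Omega : measurableType d) (R : realType).
Variables (P : probability Omega R) (p q : nat) (Y : {RV P >-> R})
  (Z : {RV P >-> q.-tuple R}) (X : {RV P >-> p.-tuple R}).

Let mX : measurable_fun setT X. Proof. exact: measurable_funPT. Qed.
Let mZ : measurable_fun setT Z. Proof. exact: measurable_funPT. Qed.
Let mXZ : measurable_fun setT (joint X Z).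
Proof. exact: measurable_cat_tuple. Qed.
Let mid : measurable_fun setT (@idfun Omega). Proof. exact: measurable_id. Qed.

Lemma EFin_survival_gap d1 d2 (U1 : measurableType d1) (U2 : measurableType d2)
    (V1 : Omega -> U1) (V2 : Omega -> U2) :
  measurable_fun setT V1 -> measurable_fun setT V2 ->
  (survival_gap Y V1 V2)%:E = (\int[distribution P Y]_t
    (cond_survival_sq Y V1 t - cond_survival_sq Y V2 t)%:E)%E.
Proof.
move=> m1 m2; rewrite EFin_Rintegral//.
by apply: ess_boundedB; exact: ess_bounded_cond_survival_sq.
Qed.

(** The inner variance conditions P(Y >= t | X, Z) on X; the tower property
    identifies its conditional mean with P(Y >= t | X). *)
Lemma T_numE : T_num Y Z X = (survival_gap Y (joint X Z) X)%:E.
Proof.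
rewrite EFin_survival_gap//; apply: eq_integral => t _.
have bS := ess_bounded_survival Y t.
have bV := ess_bounded_cond_survival Y mXZ t.
suff -> : cond_survival_sq Y X t =
    \int[P]_w (condexp P X (condprob P (joint X Z) (survival Y t)) w ^+ 2).
  exact: (expectation_condvar mX bV).
apply: eq_ae_Rintegral.
- exact: (ess_boundedX (condexp_bounded mX bS)).1.
- exact: (ess_boundedX (condexp_bounded mX bV)).1.
- have := condexp_tower mXZ mX (@joint_sigma_l _ _ _ _ _ _ _) bS.
  by apply: filterS => w ->.
Qed.

Lemma T_denE : T_den Y X = (survival_gap Y (@idfun Omega) X)%:E.
Proof.
rewrite EFin_survival_gap//; apply: eq_integral => t _.
apply: etrans; last by rewrite cond_survival_sq_id.
exact: (expectation_condvar mX (ess_bounded_survival Y t)).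
Qed.

Lemma sub_sigma_id d1 (U1 : measurableType d1) (V1 : Omega -> U1) :
  measurable_fun setT V1 ->
  g_sigma_algebra_preimage V1 `<=` g_sigma_algebra_preimage (@idfun Omega).
Proof.
by move=> m1 A /(preimage_measurable m1) mA; exists A => //; rewrite setTI.
Qed.

Lemma condprob_id t : \forall w \ae P,
  condprob P (@idfun Omega) (survival Y t) w = \1_(survival Y t) w.
Proof.
apply: (as_function_of_survivalP Y mid).1.
by exists Y; split; [exact: measurable_funPT|exact: aeW].
Qed.

Lemma survival_gap_id d1 (U1 : measurableType d1) (V1 : Omega -> U1) :
  measurable_fun setT V1 ->
  survival_gap Y (@idfun Omega) V1 = 0 <-> as_function_of P Y V1.
Proof.
move=> m1; apply: (iff_trans (survival_gap_eq0 Y mid m1 (sub_sigma_id m1))).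
apply: iff_sym; apply: (iff_trans (as_function_of_survivalP Y m1)).
split=> h t; near=> w.
- have -> : condprob P V1 (survival Y t) w = \1_(survival Y t) w.
    by near: w; exact: h.
  by near: w; exact: condprob_id.
- have <- : condprob P (@idfun Omega) (survival Y t) w =
    condprob P V1 (survival Y t) w by near: w; exact: h.
  by near: w; exact: condprob_id.
Unshelve. all: by end_near. Qed.

End coefficient.

(** * The coefficient *)

Local Open Scope ereal_scope.

Theorem theorem2p1 (d : measure_display) (Omega : measurableType d)
    (R : realType) (P : probability Omega R) (p q : nat) (hq : (0 < q)%N)
    (Y : {RV P >-> R}) (Z : {RV P >-> q.-tuple R}) (X : {RV P >-> p.-tuple R})
    (hY : ~ as_function_of P Y X) :
  [/\ T_den Y X != 0,
      0 <= T_coef Y Z X <= 1,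
      T_coef Y Z X = 0 <-> cond_independent P Y Z X &
      T_coef Y Z X = 1 <-> as_function_of P Y (joint X Z)].
Proof.
have mX : measurable_fun setT X by exact: measurable_funPT.
have mZ : measurable_fun setT Z by exact: measurable_funPT.
have mXZ : measurable_fun setT (joint X Z) by exact: measurable_cat_tuple.
have sX := @joint_sigma_l _ _ _ _ _ X Z.
have sZ := @joint_sigma_r _ _ _ _ _ X Z.
have mid : measurable_fun setT (@idfun Omega) by exact: measurable_id.
have numE := T_numE Y Z X.
have denE := T_denE Y X; rewrite (survival_gapD Y mid mXZ mX) in denE.
have n0 := survival_gap_ge0 Y mXZ mX sX.
have m0 := survival_gap_ge0 Y mid mXZ (sub_sigma_id mXZ).
have nP := survival_gap_eq0 Y mXZ mX sX.
have mP := survival_gap_id Y mXZ.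
have mn_eq0 : (survival_gap Y (@idfun Omega) (joint X Z) +
    survival_gap Y (joint X Z) X)%R <> 0%R.
  by rewrite -(survival_gapD Y mid mXZ mX) => /(survival_gap_id Y mX).
(* What remains is arithmetic on the values m and n of the two gaps. *)
move: (survival_gap Y (joint X Z) X) (survival_gap Y (@idfun Omega) (joint X Z))
  numE denE n0 m0 nP mP mn_eq0 => n m numE denE n0 m0 nP mP /eqP mn0.
have mnp : (0 < m + n)%R by rewrite lt_neqAle eq_sym mn0; exact: addr_ge0.
have coefE : T_coef Y Z X = (n / (m + n))%:E.
  by rewrite /T_coef numE denE inver (negbTE mn0).
split.
- by rewrite denE eqe.
- rewrite coefE !lee_fin divr_ge0 ?addr_ge0//=.
  by rewrite ler_pdivrMr// mul1r lerDr.
- rewrite coefE; apply: (@iff_trans _ (n = 0%R)).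
    split=> [[] /eqP|->]; last by rewrite mul0r.
    by rewrite mulf_eq0 invr_eq0 (negbTE mn0) orbF => /eqP.
  apply: (iff_trans nP); split.
  + exact: cond_independent_of_survival.
  + apply: survival_of_cond_independent => //; exact: joint_sigma_rectangles.
- rewrite coefE; apply: (@iff_trans _ (m = 0%R)); last exact: mP.
  split=> [[]|m00].
    by move/(canRL (divfK mn0)); rewrite mul1r => /eqP; rewrite eq_sym addrC
      -subr_eq0 [(n + m)%R]addrC addrK => /eqP.
  by rewrite m00 add0r divff//; rewrite m00 add0r in mn0.
Qed.
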